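(* Let $G$ be a finite group and let $H$ be a nontrivial proper subgroup of $G$. Suppose that $H$ is not normal in $G$. Let $N$ be the normal closure of $H$ in $G$. If the pair $(G,H)$ satisfies condition $(\mathrm{F}')$, then the pair $(G,N)$ satisfies condition $(\mathrm{F}')$ and $N$ is nilpotent.
   Context: For a finite group $G$ and a subgroup $K$ of $G$, the pair $(G,K)$ satisfies condition $(\mathrm{F}')$ if $1<K<G$ (that is, $K$ is a nontrivial proper subgroup of $G$) and for all $x\in G\setminus K$ and all $k\in K$, the element $xk$ is conjugate in $G$ to $x$ or to $x^{-1}$. The normal closure of $H$ in $G$ is the smallest normal subgroup of $G$ containing $H$. *)

(* Defs.v *)
From mathcomp Require Import all_boot all_fingroup all_solvable.

Set Implicit Arguments.
Unset Strict Implicit.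
Unset Printing Implicit Defensive.

Local Open Scope group_scope.

(* Condition (F'); x ^: G is the conjugacy class of x in G. *)
Definition condFprime (gT : finGroupType) (G K : {group gT}) : Prop :=
  [/\ K :!=: 1, K \proper G &
      forall x k, x \in G :\: K -> k \in K ->
        x * k \in x ^: G \/ x * k \in x^-1 ^: G].

(* The smallest normal subgroup of G containing H; this is meaningful when
   H \subset G, so that G itself belongs to the intersected family. *)
Definition normal_closure (gT : finGroupType) (G H : {group gT}) : {group gT} :=
  [group of \bigcap_(M : {group gT} | (M <| G) && (H \subset M)) M].

Lemma normal_closure_smallest (gT : finGroupType) (G H : {group gT}) :
  H \subset G ->
  [/\ normal_closure G H <| G, H \subset normal_closure G H &
      forall M : {group gT}, M <| G -> H \subset M ->
        normal_closure G H \subset M].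
Proof.
move=> sHG; split.
- apply/andP; split; first by apply: (bigcap_inf G); rewrite normal_refl.
  rewrite /=; apply: norms_bigcap; apply/bigcapsP => M /andP[nMG _].
  exact: normal_norm nMG.
- by apply/bigcapsP => M /andP[].
- by move=> M nMG sHM; apply: (bigcap_inf M); rewrite nMG.
Qed.

(* Main.v *)
Require Import Defs.
From mathcomp Require Import all_boot all_fingroup all_solvable.
From mathcomp Require Import ssralg.

(** Write [D x] for the union of the classes of [x] and [x^-1] in [G], so that
    condition (F') says that [D (x * k) = D x] for [x] outside the subgroup
    and [k] inside it. Let [N] be the normal closure of [H] and [C] its normal
    core.

    If [x] avoids all conjugates of [H], then so does [D x], hence right
    multiplication by any conjugate of [H] preserves [D x], and therefore so
    does right multiplication by [N] ([absorbs_normal_closure]). For [x] in [N]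
    this would put [1] in [D x]; thus [N] is the union of the conjugates of
    [H] ([normal_closure_cover]), and outside [N] condition (F') holds for
    [N].

    The key remark is that if [x] lies in [K] but not in [L], and [y] in [L]
    but not in [K], where [K] and [L] are conjugates of [H], then
    [D x = D (x * y) = D (y * x) = D y]. A group is not the union of two proper
    subgroups, so these coincidences propagate over all pairs of conjugates:
    [N :\: C] lies in a single [D z] ([real_class_outside_core]). All its
    elements then have the same order, which forces them to be [p]-elements
    for one prime [p], and [N / C] is a [p]-group.

    If [G / C] were a [p]-group, [z] could be chosen central modulo [C]; then
    all of [N :\: C] would be congruent to [z] or [z^-1] modulo [C], leaving no
    room for [H] strictly between [C] and [N]
    ([single_real_class_not_pgroup]). Hence some prime [s] other than [p]
    divides the order of [G / N]; in particular [N] is proper.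

    It remains to see that [C] is a [p]-group ([core_pgroup]), for then so is
    [N]. Otherwise a nontrivial abelian [q]-subgroup [V] of [C], with
    [q != p], is normalised by a [p]-subgroup [P] of [N] not contained in [C]
    and by an element [x] of order [s] outside [N] that also normalises [P].
    No element of [P] outside [C] commutes with a nontrivial element of [V],
    because [N :\: C] consists of [p]-elements. On the other hand all elements
    of [x *: N] have order [s], so on [V] the norms of all the [x * y], with
    [y] in [P], vanish; adding them up shows that [#|P|] kills [V]
    ([twisted_norm_kills]), a contradiction. *)

Set Implicit Arguments.
Unset Strict Implicit.
Unset Printing Implicit Defensive.

Import GRing.Theory FiniteModule.
Local Open Scope group_scope.

(** * Vanishing norms on an abelian group *)

Lemma expg_coprime_inj (gT : finGroupType) (a b : gT) (s i : nat) :
  coprime i s -> (0 < i)%N -> a ^+ s = 1 -> b ^+ s = 1 ->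
  a ^+ i = b ^+ i -> a = b.
Proof.
move=> co_is i_gt0 as1 bs1 eq_ab.
have [[u v] /= uv1] := coprimeP s i_gt0 co_is.
have Dui: (i * u = s * v + 1)%N.
  rewrite ![(_ * u)%N]mulnC ![(s * v)%N]mulnC addnC -uv1 subnK //.
  by rewrite ltnW // -subn_gt0 uv1.
have pow1 (c : gT) : c ^+ s = 1 -> c = (c ^+ i) ^+ u.
  by move=> cs1; rewrite -expgM Dui expgD expgM cs1 expg1n mul1g expg1.
by rewrite (pow1 a) // (pow1 b) // eq_ab.
Qed.

(** Moving the [n] factors [a] to the left conjugates the copies of [v] by
    successive powers of [a]. *)
Lemma fmod_expgM (gT : finGroupType) (V : {group gT}) (abV : abelian V)
    (a v : gT) (n : nat) :
  a \in 'N(V) -> v \in V ->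
  exists2 w, w \in V & (a * v) ^+ n = a ^+ n * w /\
    fmod abV w = (\sum_(i < n) actr (fmod abV v) (a ^+ i))%R.
Proof.
move=> nVa Vv; elim: n => [|n [w Vw [Dw sum_w]]].
  by exists 1; rewrite ?group1 // big_ord0 mulg1 fmod1.
have Vwa: w ^ a \in V by rewrite memJ_norm.
exists (w ^ a * v); first by rewrite groupM.
split; first by rewrite !expgSr Dw conjgE !mulgA mulgK.
rewrite fmodM // fmodJ // sum_w actr_sum big_ord_recl expg0 actr1 addrC.
congr (_ + _)%R; apply: eq_bigr => i _.
by rewrite -actrM ?groupX // -expgSr.
Qed.

(** Summing over [y] in [R] the relations [\sum_(i < s) v ^@ (x * y) ^+ i = 0]
    isolates [v]: for [0 < i < s] the map taking [x * y] to its [i]-th power is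
    a bijection of the coset of [x] onto that of [x ^+ i], so the terms of
    exponent [i] add up to the sum of an element over [R], which is fixed by
    [R] and hence zero. *)
Lemma twisted_norm_kills (gT : finGroupType) (V R : {group gT})
    (x : gT) (s : nat) :
  abelian V -> R \subset 'N(V) -> x \in 'N(V) -> x \in 'N(R) -> prime s ->
  {in R & V, forall y v, (x * y * v) ^+ s = 1} -> 'C_V(R) = 1 ->
  {in V, forall v, v ^+ #|R| = 1}.
Proof.
move=> abV nVR nVx nRx s_pr ord_s cVR1 v Vv.
have ord_xR: {in R, forall y, (x * y) ^+ s = 1}.
  by move=> y Ry; rewrite -(mulg1 (x * y)) ord_s.
have nVxR: {in R, forall y, x * y \in 'N(V)}.
  by move=> y Ry; rewrite groupM // (subsetP nVR).
(* A sum over R is fixed by R, hence vanishes. *)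
have sumR0 u : (\sum_(y in R) actr u y = 0 :> fmod_of abV)%R.
  set S := (\sum_(y in R) _)%R.
  suffices: val S \in 'C_V(R) by rewrite cVR1 => /set1P S1; apply: val_inj.
  rewrite inE fmodP; apply/centP=> z Rz; apply/commgP/conjg_fixP.
  have nVz := subsetP nVR z Rz.
  rewrite -fmvalJ // /S actr_sum; congr (val _).
  rewrite [RHS](reindex_inj (mulIg z)) /=.
  apply: eq_big => y; first by rewrite groupMr.
  by move=> Ry; rewrite -actrM // (subsetP nVR).
(* Both x * y and x * y * v have trivial s-th power. *)
have norm0: {in R, forall y,
    (\sum_(i < s) actr (fmod abV v) ((x * y) ^+ i) = 0)%R}.
  move=> y Ry; have [w Vw [Dw <-]] := fmod_expgM abV s (nVxR y Ry) Vv.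
  by rewrite -[w]mul1g -(ord_xR y Ry) -Dw ord_s // fmod1.
apply: (injmP (injm_fmod abV)); rewrite ?groupX ?group1 //= fmodX // fmod1.
have: (\sum_(y in R) \sum_(i < s) actr (fmod abV v) ((x * y) ^+ i) = 0)%R.
  exact: big1.
rewrite exchange_big /=.
have [n Ds] : exists n, s = n.+1.
  by case: (s) (prime_gt0 s_pr) => // n _; exists n.
move: norm0 ord_s ord_xR s_pr; rewrite {}Ds => _ _ ord_xR s_pr.
rewrite big_ord_recl [X in (_ + X)%R]big1 => [|i _]; last first.
  rewrite lift0.
  (* The i.+1-st powers of the x * y run over the coset x ^+ i.+1 *: R. *)
  pose f y := (x ^+ i.+1)^-1 * (x * y) ^+ i.+1.
  have Rf: {in R, forall y, f y \in R}.
    move=> y Ry; rewrite /f.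
    elim: (i.+1) => [|k IHk]; first by rewrite invg1 mulg1.
    have ->: (x ^+ k.+1)^-1 * (x * y) ^+ k.+1
           = ((x ^+ k)^-1 * (x * y) ^+ k) ^ x * y.
      by rewrite !expgSr invMg conjgE !mulgA.
    by rewrite groupM // memJ_norm.
  have inj_f: {in R &, injective f}.
    move=> y z Ry Rz /mulgI; move/(@expg_coprime_inj _ _ _ n.+1 _).
    rewrite !ord_xR // => eq_xy; apply/(mulgI x)/eq_xy => //.
    by rewrite coprime_sym prime_coprime // gtnNdvd // ltnS.
  have fR: f @: R = R.
    apply/eqP; rewrite eqEcard card_in_imset // leqnn andbT.
    by apply/subsetP=> _ /imsetP[y Ry ->]; apply: Rf.
  rewrite -[RHS](sumR0 (actr (fmod abV v) (x ^+ i.+1))).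
  rewrite -[in RHS]fR big_imset //=.
  apply: eq_bigr => y Ry.
  rewrite -actrM ?groupX //; first by rewrite /f mulKVg.
  by rewrite (subsetP nVR) // Rf.
(* The powers of exponent 0 contribute #|R| copies of v. *)
rewrite addr0 => <-; rewrite -sumr_const.
by apply: eq_bigr => y _; rewrite expg0 actr1.
Qed.

(** * Real classes and absorption *)

Definition real_class (gT : finGroupType) (G : {group gT}) (x : gT) :=
  x ^: G :|: x^-1 ^: G.

Definition absorbs (gT : finGroupType) (G K : {group gT}) :=
  forall x k, x \in G -> x \notin K -> k \in K ->
    real_class G (x * k) = real_class G x.

Section RealClass.
Variables (gT : finGroupType) (G : {group gT}).
Implicit Types (x y z : gT) (H K L M N : {group gT}).
Local Notation D := (real_class G).

Lemma real_class_refl x : x \in D x.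
Proof. by rewrite inE class_refl. Qed.

Lemma real_class_eq x y : y \in D x -> D y = D x.
Proof.
case/setUP=> /class_eqP yx; rewrite /real_class !classVg yx //.
by rewrite classVg invgK setUC.
Qed.

Lemma real_classJ x g : g \in G -> D (x ^ g) = D x.
Proof. by move=> Gg; rewrite /real_class -conjVg !classGidl. Qed.

Lemma real_class_mulC x y : x \in G -> D (y * x) = D (x * y).
Proof.
by move=> Gx; rewrite -(real_classJ (x * y) Gx) conjgE !mulgA mulVg mul1g.
Qed.

Lemma order_real_class x y : D x = D y -> #[x] = #[y].
Proof.
move=> Dxy; have: x \in D y by rewrite -Dxy real_class_refl.
by case/setUP=> /imsetP[g _ ->]; rewrite orderJ ?orderV.
Qed.

Lemma condFprime_absorbs H : condFprime G H -> absorbs G H.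
Proof.
case=> _ _ FH x k Gx H'x Hk; apply: real_class_eq.
by apply/setUP; apply: FH; rewrite // inE H'x.
Qed.

Lemma absorbsJ H g : g \in G -> absorbs G H -> absorbs G (H :^ g).
Proof.
move=> Gg absH x k Gx; rewrite !mem_conjg => H'x Hk.
have GgV: g^-1 \in G by rewrite groupV.
by rewrite -(real_classJ (x * k) GgV) conjMg absH ?(groupJ Gx) // real_classJ.
Qed.

(** Both [x * y] and [y * x] are obtained by absorbing the right factor, and
    they are conjugate. *)
Lemma absorbs_crossing K L x y :
  K \subset G -> L \subset G -> absorbs G K -> absorbs G L ->
  x \in K :\: L -> y \in L :\: K -> D x = D y.
Proof.
move=> sKG sLG absK absL /setDP[Kx L'x] /setDP[Ly K'y].
have [Gx Gy] := (subsetP sKG x Kx, subsetP sLG y Ly).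
by rewrite -(absL x y) // -(absK y x) // real_class_mulC.
Qed.

(** The intended instance is the family of conjugates of a subgroup satisfying
    (F'); the common cardinality rules out strict inclusions. *)
Definition absorbing_family (P : pred {group gT}) n :=
  forall K, P K -> [/\ K \subset G, absorbs G K & #|K| = n].

Lemma absorbing_family_diff P n K L : absorbing_family P n -> P K -> P L ->
  K != L -> exists x, x \in K :\: L.
Proof.
move=> famP PK PL neqKL; apply/set0Pn; apply: contra neqKL.
rewrite setD_eq0 => sKL; have [[_ _ cK] [_ _ cL]] := (famP K PK, famP L PL).
by apply/eqP/group_inj/eqP; rewrite eqEcard sKL cK cL leqnn.
Qed.

(** When [x] lies in [M] and [y] in [L], their product lies in neither, and
    serves as an intermediate point; this is the usual argument that [K] is not
    the union of its proper subgroups [K :&: L] and [K :&: M]. *)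
Lemma absorbing_family_diff_l P n K L M x y : absorbing_family P n ->
  P K -> P L -> P M -> x \in K :\: L -> y \in K :\: M -> D x = D y.
Proof.
move=> famP PK PL PM.
have [sKG absK _] := famP K PK.
suffices base L1 u v : P L1 -> u \in K :\: L1 -> v \in K :\: L1 -> D u = D v.
  move=> KLx KMy; have [[Kx L'x] [Ky M'y]] := (setDP KLx, setDP KMy).
  have [Mx | M'x] := boolP (x \in M); last first.
    by apply: (base M); rewrite // inE M'x.
  have [Ly | L'y] := boolP (y \in L); last first.
    by apply: (base L); rewrite // inE L'y.
  transitivity (D (x * y)).
    by apply: (base L); rewrite // inE (groupM Kx Ky) groupMr // L'x.
  by apply: (base M); rewrite // inE (groupM Kx Ky) groupMl // M'y.
move=> PL1 KLu KLv; have [sL1G absL1 _] := famP L1 PL1.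
have neqLK: L1 != K.
  by apply: contraTneq KLu => ->; rewrite setDv inE.
have [z LKz] := absorbing_family_diff famP PL1 PK neqLK.
have crossing := absorbs_crossing sKG sL1G absK absL1.
by rewrite (crossing u z) // (crossing v z).
Qed.

Lemma absorbing_family_class P n K L K1 L1 x y : absorbing_family P n ->
  P K -> P L -> P K1 -> P L1 -> x \in K :\: L -> y \in K1 :\: L1 -> D x = D y.
Proof.
move=> famP PK PL PK1 PL1 KLx KLy.
have [eqK | neqK] := eqVneq K K1.
  by rewrite -eqK in KLy; apply: (absorbing_family_diff_l famP PK PL PL1).
have [u KK1u] := absorbing_family_diff famP PK PK1 neqK.
rewrite eq_sym in neqK.
have [w K1Kw] := absorbing_family_diff famP PK1 PK neqK.
have [[sKG absK _] [sK1G absK1 _]] := (famP K PK, famP K1 PK1).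
rewrite (absorbing_family_diff_l famP PK PL PK1 KLx KK1u).
rewrite (absorbs_crossing sKG sK1G absK absK1 KK1u K1Kw).
exact: (absorbing_family_diff_l famP PK1 PK PL1).
Qed.

Lemma normal_closure_gen H : H \subset G ->
  normal_closure G H \subset <<class_support H G>>.
Proof.
move=> sHG; have [_ _ minN] := normal_closure_smallest sHG.
apply: (minN <<class_support H G>>%G).
  rewrite /normal gen_subG class_support_subG //=.
  exact: subset_trans (class_support_norm H G) (norm_gen _).
exact: subset_trans (sub_class_support G H) (subset_gen _).
Qed.

(** The right stabiliser of [D x] contains every conjugate of [H], because [D x]
    avoids all of them as [x] does; being a group, it contains the normal
    closure. *)
Lemma absorbs_normal_closure H x k : H \subset G -> absorbs G H -> x \in G ->
  x \notin class_support H G -> k \in normal_closure G H -> D (x * k) = D x.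
Proof.
move=> sHG absH Gx S'x /(subsetP (normal_closure_gen sHG)) Sk.
suffices: <<class_support H G>> \subset 'N(D x | 'R).
  move/subsetP/(_ k Sk)/(astabs_act x).
  by rewrite real_class_refl => /real_class_eq.
rewrite gen_subG; apply/subsetP=> _ /imset2P[h g Hh Gg ->].
rewrite inE in_setT inE /=; apply/subsetP=> y Dy; rewrite inE /=.
have D_y := real_class_eq Dy.
have Gy: y \in G.
  by case/setUP: Dy => /imsetP[t Gt ->]; rewrite groupJ ?groupV.
have S'y: y \notin H :^ g.
  apply: contra S'x => Hgy; have Sy: y \in class_support H G.
    by apply: (subsetP _ y Hgy); rewrite class_supportEr (bigcup_sup g).
  have nS t: t \in G -> forall z, z \in class_support H G ->
      z ^ t \in class_support H G.
    by move=> Gt z Sz; rewrite memJ_norm // (subsetP (class_support_norm H G)).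
  have SV z: z \in class_support H G -> z^-1 \in class_support H G.
    case/imset2P=> h1 g1 Hh1 Gg1 ->.
    by rewrite -conjVg memJ_class_support ?groupV.
  have: x \in D y by rewrite D_y real_class_refl.
  by case/setUP=> /imsetP[t Gt ->]; apply: nS => //; apply: SV.
have Hghg: h ^ g \in H :^ g by rewrite memJ_conjg.
have := absorbsJ Gg absH Gy S'y Hghg; rewrite D_y => <-.
exact: real_class_refl.
Qed.

(** An element [x] of the normal closure outside all conjugates would absorb
    [x^-1]. *)
Lemma normal_closure_cover H : H \subset G -> absorbs G H ->
  normal_closure G H \subset class_support H G.
Proof.
move=> sHG absH; have [nsNG _ _] := normal_closure_smallest sHG.
apply/subsetP=> x Nx; apply: contraT => S'x.
have Gx := subsetP (normal_sub nsNG) x Nx.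
have NxV: x^-1 \in normal_closure G H by rewrite groupV.
have := absorbs_normal_closure sHG absH Gx S'x NxV.
rewrite mulgV => D1; have: x \in D 1 by rewrite D1 real_class_refl.
rewrite /real_class invg1 setUid class1G => /set1P x1.
by rewrite x1 mem_class_support ?group1 in S'x.
Qed.

Lemma real_class_outside_core H x y : H \subset G -> absorbs G H ->
  x \in normal_closure G H :\: gcore H G ->
  y \in normal_closure G H :\: gcore H G -> D x = D y.
Proof.
move=> sHG absH.
pose P (K : {group gT}) := [exists g in G, K == H :^ g :> {set gT}].
have PJ g : g \in G -> P (H :^ g)%G.
  by move=> Gg; apply/existsP; exists g; rewrite Gg /=.
have famP: absorbing_family P #|H|.
  move=> K /existsP[g /andP[Gg /eqP DK]].
  have ->: K = (H :^ g)%G by apply: val_inj.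
  by split; [rewrite /= conj_subG | apply: absorbsJ | rewrite /= cardJg].
have split_core z : z \in normal_closure G H :\: gcore H G ->
  exists a, exists b, [/\ a \in G, b \in G & z \in (H :^ a :\: H :^ b)].
- case/setDP=> /(subsetP (normal_closure_cover sHG absH)).
  rewrite class_supportEr => /bigcupP[a Ga Haz] C'z.
  have: ~~ [forall b in G, z \in H :^ b].
    apply: contra C'z => /forallP Cz.
    by apply/bigcapP=> b Gb; have:= Cz b; rewrite Gb.
  rewrite negb_forall => /existsP[b]; rewrite negb_imply => /andP[Gb Hb'z].
  by exists a, b; rewrite inE Hb'z.
case/split_core=> a [b [Ga Gb xab]] /split_core[c [d [Gc Gd ycd]]].
by apply: absorbing_family_class famP _ _ _ _ xab ycd; apply: PJ.
Qed.

End RealClass.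

(** * Prime-power order outside the core *)

Lemma not_pgroup_prime (gT : finGroupType) (A : {group gT}) (p : nat) :
  ~~ p.-group A -> exists2 q, prime q & q != p /\ q %| #|A|.
Proof.
move=> not_pA.
have [/allP all_p | /allPn[q]] := boolP (all (pred1 p) (primes #|A|)).
  case/negP: not_pA; apply/pgroupP=> r r_pr r_dv; apply: all_p.
  by rewrite mem_primes r_pr cardG_gt0.
by rewrite mem_primes => /and3P[q_pr _ q_dv] neq_qp; exists q.
Qed.

Lemma p_p'_elt_1 (gT : finGroupType) (pi : nat_pred) (x : gT) :
  pi.-elt x -> pi^'.-elt x -> x = 1.
Proof.
by move=> pi_x pi'x; apply/eqP; rewrite -order_eq1 (pnat_1 pi_x pi'x).
Qed.

(** Some primary constituent of some [x] outside [C] also lies outside [C], and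
    its order is the common order. *)
Lemma equal_order_p_elt (gT : finGroupType) (N C : {group gT}) :
  ~~ (N \subset C) -> {in N :\: C &, forall x y, #[x] = #[y]} ->
  exists p : nat, {in N :\: C, forall x, p.-elt x}.
Proof.
move=> /subsetPn[x Nx C'x] eq_ord.
have [p C'xp]: exists p : nat, x.`_p \notin C.
  have [/allP Cx | /allPn[p _ C'xp]] :=
    boolP (all (fun p : nat => x.`_p \in C) (index_iota 0 #[x].+1)).
    case/negP: C'x; rewrite -(prod_constt x) big_seq; apply: group_prod => p.
    exact: Cx.
  by exists p.
have Nxp: x.`_p \in N :\: C by rewrite inE C'xp groupX.
by exists p => y Ny; rewrite /p_elt (eq_ord y _ Ny Nxp); apply: p_elt_constt.
Qed.

Lemma quotient_p_elt_pgroup (gT : finGroupType) (N C : {group gT}) p :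
  C <| N -> {in N :\: C, forall x, p.-elt x} -> p.-group (N / C).
Proof.
move=> /andP[_ nCN] pN; apply/pgroupP=> q q_pr /Cauchy[//|xb Nxb ord_xb].
have /morphimP[x nCx Nx Dxb] := Nxb.
have NCx: x \in N :\: C.
  rewrite inE Nx andbT; apply: contraTN q_pr => Cx.
  by rewrite -ord_xb Dxb /= coset_id // order1.
have := morph_p_elt (coset_morphism C) nCx (pN x NCx).
by rewrite /p_elt -Dxb ord_xb pnatE.
Qed.

(** In a [p]-group [G / C], the normal subgroup [N / C] contains a nontrivial
    central element, conjugate only to itself modulo [C]; so every element of
    [N :\: C] generates the same cyclic group modulo [C], and one of
    them lies in [H]. *)
Lemma single_real_class_not_pgroup (gT : finGroupType) (G N H C : {group gT})
    (p : nat) :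
  N <| G -> C <| G -> C \proper H -> H \proper N ->
  {in N :\: C &, forall x y, real_class G x = real_class G y} ->
  ~~ p.-group (G / C).
Proof.
move=> nsNG nsCG /properP[sCH [h Hh C'h]] /andP[sHN not_sNH] oneD.
apply: contra not_sNH => pGC.
have nCG := normal_norm nsCG; have nCN := subset_trans (normal_sub nsNG) nCG.
have ntNC: N / C != 1.
  apply/trivgPn; exists (coset C h).
    by rewrite mem_quotient // (subsetP sHN).
  apply: contra C'h => /eqP/coset_idr-> //.
  by rewrite (subsetP nCN) // (subsetP sHN).
have := meet_center_nil (pgroup_nil pGC) (quotient_normal C nsNG) ntNC.
case/trivgPn=> zb /setIP[/morphimP[z nCz Nz ->] Zz] ntz.
have C'z: z \notin C by apply: contra ntz => Cz; rewrite /= coset_id.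
have cycle_z: {in N :\: C, forall y, <[coset C y]> = <[coset C z]>}.
  move=> y NCy; have nCy := subsetP nCN y (setDP NCy).1.
  have: y \in real_class G z.
    by rewrite (oneD z y) ?real_class_refl // inE C'z.
  have cz g : g \in G -> coset C z ^ coset C g = coset C z.
    move=> Gg; apply/conjg_fixP/commgP.
    by case/setIP: Zz => _ /centP; apply; rewrite mem_quotient.
  case/setUP=> /imsetP[g Gg ->]; have nCg := subsetP nCG g Gg.
    by rewrite morphJ //= cz.
  by rewrite morphJ ?groupV //= morphV //= conjVg cz // cycleV.
have sub_zH: <[coset C z]> \subset H / C.
  rewrite -(cycle_z h) ?cycle_subG ?mem_quotient //.
  by rewrite inE C'h (subsetP sHN).
rewrite -(quotientSGK nCN sCH); apply/subsetP=> _ /morphimP[y nCy Ny ->].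
have [Cy | C'y] := boolP (y \in C); first by rewrite /= coset_id ?group1.
by rewrite (subsetP sub_zH) // -(cycle_z y) ?cycle_id // inE C'y.
Qed.

(** * The core is a p-group *)

(** The product [y * v] lies outside [C], and its [p']-part is [v]. *)
Lemma commuting_p'_elt1 (gT : finGroupType) (N C : {group gT}) (p : nat) :
  C \subset N -> {in N :\: C, forall x, p.-elt x} ->
  forall y v, y \in N :\: C -> v \in C -> p^'.-elt v -> commute y v -> v = 1.
Proof.
move=> sCN pN y v NCy Cv p'v cyv; have [Ny C'y] := setDP NCy.
have pyv: p.-elt (y * v).
  by rewrite pN // inE groupMr // C'y groupM // (subsetP sCN).
have p'part1 (z : gT) : p.-elt z -> z.`_p^' = 1.
  by move=> pz; apply/constt1P; rewrite p_eltNK.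
have := consttM p^' cyv; rewrite (constt_p_elt p'v) (p'part1 _ pyv).
by rewrite p'part1 ?pN // mul1g.
Qed.

Lemma quotient_Cauchy_elt (gT : finGroupType) (U N : {group gT}) (s : nat) :
  prime s -> s %| #|U / N| ->
  exists2 x, x \in U & [/\ x \notin N, x ^+ s \in N & s.-elt x].
Proof.
move=> s_pr /(Cauchy s_pr)[xb /morphimP[x nNx Ux Dxb] ord_xb].
have Dxbs: coset N x.`_s = xb.
  rewrite (morph_constt (coset_morphism N)) //= -Dxb constt_p_elt //.
  by rewrite /p_elt ord_xb pnat_id.
exists x.`_s; first exact: groupX.
split; last exact: p_elt_constt.
  by apply/negP=> /coset_id Nxs; move: s_pr; rewrite -ord_xb -Dxbs Nxs order1.
apply: coset_idr; rewrite ?groupX //.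
by rewrite morphX ?groupX //= Dxbs -ord_xb expg_order.
Qed.

(** If [C] were not a [p]-group, the centre of a Sylow [q]-subgroup of [C] would
    be killed by the order of a [p]-group, by [twisted_norm_kills]. *)
Lemma core_pgroup (gT : finGroupType) (G N C : {group gT}) (p s : nat) :
  N <| G -> C <| G -> C \subset N -> ~~ (N \subset C) ->
  {in N :\: C, forall x, p.-elt x} ->
  {in G :\: N & N, forall x k, #[x * k] = #[x]} ->
  prime s -> s != p -> s %| #|G / N| -> p.-group C.
Proof.
move=> nsNG nsCG sCN not_sNC pN eq_ord s_pr neq_sp s_dv.
have [sNG nNG] := andP nsNG; have [sCG nCG] := andP nsCG.
apply: contraT => not_pC.
(* Choosing q = s whenever possible ensures x ^+ s = 1 below. *)
have [q q_pr [neq_qp q_dv sq]] : exists2 q, prime q &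
    [/\ q != p, q %| #|C| & s %| #|C| -> q = s].
  have [s_dvC | s'C] := boolP (s %| #|C|); first by exists s.
  have [q q_pr [neq_qp q_dv]] := not_pgroup_prime not_pC.
  by exists q => //; split=> // s_dvC; rewrite s_dvC in s'C.
have fpf := commuting_p'_elt1 sCN pN.
(* Two Frattini arguments make x normalise both Q and P. *)
have [Q sylQ] := Sylow_exists q C; have [sQC qQ _] := and3P sylQ.
pose T := 'N_G(Q)%G.
have defG: C * T = G := Frattini_arg nsCG sylQ.
have [P sylP] := Sylow_exists p (T :&: N)%G.
have [sPTN pP _] := and3P sylP.
have nsTN: T :&: N <| T by apply: normalGI nsNG; apply: subsetIl.
pose U := 'N_T(P)%G.
have defT: (T :&: N) * U = T := Frattini_arg nsTN sylP.
have sUG: U \subset G by rewrite !subIset ?subxx.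
have GN_U: G / N = U / N.
  rewrite -defG quotientMl ?(subset_trans sCN (normG N)) // quotientS1 // mul1g.
  have nNTN: T :&: N \subset 'N(N) by rewrite subIset // normG orbT.
  by rewrite -[U / N]mul1g -(quotientS1 (subsetIr T N)) -quotientMl // defT.
have [x Ux [N'x Nxs s_x]]: exists2 x, x \in U &
    [/\ x \notin N, x ^+ s \in N & s.-elt x].
  by apply: quotient_Cauchy_elt; rewrite // -GN_U.
have [Tx nPx] := setIP Ux; have [Gx nQx] := setIP Tx.
have [y Py NCy]: exists2 y, y \in P & y \in N :\: C.
  have [y TNy C'y]: exists2 y, y \in T :&: N & y \notin C.
    apply/subsetPn; apply: contra not_sNC => sTNC.
    by rewrite -(setIidPr sNG) -defG -group_modl // mul_subG.
  have [Ty Ny] := setIP TNy.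
  have p_y: p.-elt y by rewrite pN // inE C'y.
  have [] := Sylow_Jsub sylP _ p_y; rewrite ?cycle_subG // => t TNt.
  rewrite -cycleJ cycle_subG => Pyt; exists (y ^ t) => //.
  have Gt: t \in G by case/setIP: TNt => /setIP[].
  by rewrite inE memJ_norm ?(subsetP nCG) // C'y memJ_norm ?(subsetP nNG).
(* If q = s then x ^+ s lies in Q and normalises P, so it centralises P and
   commutes with y; otherwise C is an s'-group. *)
have xs1: x ^+ s = 1.
  have s_xs: s.-elt (x ^+ s) by apply: p_eltX.
  have p'xs: p^'.-elt (x ^+ s).
    by apply: sub_p_elt s_xs => r; rewrite !inE => /eqP->.
  have Cxs: x ^+ s \in C.
    apply: contraT => C'xs.
    have p_xs: p.-elt (x ^+ s) by rewrite pN // inE C'xs.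
    by case/negP: C'xs; rewrite (p_p'_elt_1 p_xs p'xs) group1.
  have [s_dvC | s'C] := boolP (s %| #|C|).
    have Dq := sq s_dvC.
    have nsQN: Q <| 'N_C(Q) by rewrite normal_subnorm.
    have sylQN: s.-Sylow('N_C(Q)) Q.
      by rewrite -Dq; apply: pHall_subl (subsetIl _ _) sylQ; apply: normal_sub.
    have Qxs: x ^+ s \in Q.
      by rewrite (mem_normal_Hall sylQN nsQN) // inE Cxs groupX.
    have PQ1: P :&: Q = 1.
      by apply: coprime_TIg; apply: pnat_coprime pP _; rewrite (pi_pnat qQ).
    apply: (fpf y) => //; apply/commgP.
    suffices: [~ y, x ^+ s] \in P :&: Q by rewrite PQ1 => /set1P->.
    rewrite inE {1}commgEl groupM ?groupV ?memJ_norm ?groupX //=.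
    rewrite commgEr groupM // memJ_norm ?groupV //.
    by have /setIP[/setIP[_ ->]] := subsetP sPTN y Py.
  have s'xs: s^'.-elt (x ^+ s) by apply: mem_p_elt Cxs; rewrite /pgroup p'natE.
  exact: p_p'_elt_1 s_xs s'xs.
have sZC : 'Z(Q) \subset C := subset_trans (center_sub Q) sQC.
have nZT : T \subset 'N('Z(Q)).
  exact: char_norm_trans (center_char Q) (subsetIr _ _).
have q_Z : q.-group 'Z(Q) := pgroupS (center_sub Q) qQ.
have sPT: P \subset T := subset_trans sPTN (subsetIl _ _).
have sPN: P \subset N := subset_trans sPTN (subsetIr _ _).
have p'Z v : v \in 'Z(Q) -> p^'.-elt v.
  move=> Zv; apply: sub_p_elt (mem_p_elt q_Z Zv) => r.
  by rewrite !inE => /eqP->.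
have ntZ: 'Z(Q) != 1.
  apply/eqP=> /(trivg_center_pgroup qQ) Q1.
  have := card_Hall sylQ; rewrite Q1 cards1 => /esym/eqP.
  by rewrite p_part_eq1 mem_primes q_pr cardG_gt0 q_dv.
have ord_s: {in P & 'Z(Q), forall y v, (x * y * v) ^+ s = 1}.
  move=> y1 v Py1 Zv; have Nk: y1 * v \in N.
    exact: groupM (subsetP sPN _ Py1) (subsetP sCN _ (subsetP sZC _ Zv)).
  apply/eqP; rewrite -order_dvdn -mulgA eq_ord ?inE ?N'x //.
  by rewrite order_dvdn xs1.
have cZP: 'C_('Z(Q))(P) = 1.
  apply/trivgP/subsetP=> v /setIP[Zv /centP cPv]; apply/set1P.
  by apply: (fpf y); rewrite ?p'Z ?(subsetP sZC) //; apply/commute_sym/cPv.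
have kill := twisted_norm_kills (center_abelian Q) (subset_trans sPT nZT)
  (subsetP nZT x Tx) nPx s_pr ord_s cZP.
case/negP: ntZ; apply/eqP/trivgP/subsetP=> v Zv; apply/set1P.
apply: p_p'_elt_1 (p'Z v Zv); apply: pnat_dvd pP.
by rewrite order_dvdn kill.
Qed.

Theorem theorem2 (gT : finGroupType) (G H : {group gT})
  (ntH : H :!=: 1) (prHG : H \proper G) (nnHG : ~~ (H <| G))
  (FH : condFprime G H) :
  condFprime G (normal_closure G H) /\ nilpotent (normal_closure G H).
Proof.
have absH := condFprime_absorbs FH; have sHG := proper_sub prHG.
have [nsNG sHN _] := normal_closure_smallest sHG.
have oneD := @real_class_outside_core _ G H _ _ sHG absH.
have xN := @absorbs_normal_closure _ G H _ _ sHG absH.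
have sSN : class_support H G \subset normal_closure G H.
  by rewrite class_support_sub_norm // normal_norm.
move: (normal_closure G H) => N in nsNG sHN oneD xN sSN *.
pose C := [group of gcore H G].
have nsCG : C <| G := gcore_normal sHG.
have prCH : C \proper H.
  rewrite properE gcore_sub; apply: contra nnHG => sHC.
  have <-: gcore H G = H by apply/eqP; rewrite eqEsubset gcore_sub.
  exact: gcore_normal.
have prHN : H \proper N.
  rewrite properE sHN; apply: contra nnHG => sNH.
  by have <-: N :=: H by apply/eqP; rewrite eqEsubset sNH.
have prCN := proper_trans prCH prHN; have sCN := proper_sub prCN.
have [sNG nNG] := andP nsNG; have nCG := normal_norm nsCG.
have [p pN] : exists p : nat, {in N :\: C, forall x, p.-elt x}.
  apply: equal_order_p_elt => [|x y Nx Ny]; first by case/andP: prCN.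
  exact: order_real_class (oneD _ _ Nx Ny).
have pNC : p.-group (N / C).
  by apply: quotient_p_elt_pgroup pN; apply: normalS nsCG.
have not_pGN : ~~ p.-group (G / N).
  have := single_real_class_not_pgroup p nsNG nsCG prCH prHN oneD.
  apply: contra => pGN.
  rewrite /pgroup card_quotient // -(Lagrange_index sNG sCN) pnatM.
  by rewrite -!card_quotient ?(subset_trans sNG) //; apply/andP.
have [s s_pr [neq_sp s_dv]] := not_pgroup_prime not_pGN.
have absN x k :
  x \in G :\: N -> k \in N -> real_class G (x * k) = real_class G x.
- case/setDP=> Gx N'x; apply: xN => //.
  by apply: contra N'x; apply: (subsetP sSN).
split.
  split=> [||x k Gx Nk].
  - by apply: contraNneq ntH => N1; rewrite -subG1 -N1.
  - rewrite properEneq sNG andbT; apply: contraNneq not_pGN => ->.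
    by rewrite trivg_quotient pgroup1.
  apply/setUP; rewrite -[_ :|: _]/(real_class G x) -(absN x k) //.
  exact: real_class_refl.
have pC : p.-group C.
  apply: core_pgroup nsNG nsCG sCN _ pN _ s_pr neq_sp s_dv.
    by case/andP: prCN.
  by move=> x k Gx Nk; apply: order_real_class (absN x k Gx Nk).
apply: (@pgroup_nil _ p); rewrite -(pquotient_pgroup pC) //.
exact: subset_trans nCG.
Qed.
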